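(* Let $m$ be a polyhedral surface with combinatorics $(V,E,F)$, let $s$ be a mesh parallel to $m$, and for $\delta\in\mathbb{R}$ let $m^\delta=m+\delta s$ (vertex-wise linear combination). Then for every face $f\in F$ with $A(m(f))\neq 0$ the area of the corresponding face of the offset $m^\delta$ obeys the law $$A(m^\delta(f))=(1-2\delta H_f+\delta^2K_f)\,A(m(f)),$$ where $$H_f=-\frac{A(m(f),s(f))}{A(m(f))},\qquad K_f=\frac{A(s(f))}{A(m(f))}.$$
   Context: Mesh combinatorics: a 2-dimensional cell complex $(V,E,F)$ of vertices, edges, faces. A mesh is a map $m:V\to\mathbb{R}^3$, $i\mapsto m_i$. For a face $f=(i_1,\dots,i_n)$, $m(f)$ is the $n$-gon $(m_{i_1},\dots,m_{i_n})$. A mesh is a polyhedral surface if the vertices of each face are mapped to coplanar points. Two meshes $m,m'$ with the same combinatorics are parallel if for each edge $(i,j)\in E$ the vectors $m_i-m_j$ and $m'_i-m'_j$ are linearly dependent. The polyhedral surface $m$ is assumed to have no zero edges ($m_i\ne m_j$ for $(i,j)\in E$), and for each face $f$ the polygons $m(f)$, $s(f)$, $m^\delta(f)$ lie in planes parallel to a common 2-dimensional linear subspace $U_f\subset\mathbb{R}^3$. Oriented area: for an $n$-gon $P=(p_0,\dots,p_{n-1})$ in a 2-dimensional vector space $U$ with a fixed nonzero determinant form $\det$, $A(P)=\frac12\sum_{0\le i<n}\det(p_i,p_{i+1})$ (indices mod $n$); $A(P,Q)$ is the associated symmetric bilinear form, so $A(\lambda P+\mu Q)=\lambda^2A(P)+2\lambda\mu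 A(P,Q)+\mu^2A(Q)$. Both are invariant under translation of each polygon, hence are defined for polygons in planes parallel to $U_f$, using one determinant form in $U_f$ for all of them. *)

(* Defs.v *)
From HB Require Import structures.
From mathcomp Require Import all_boot all_order all_algebra.
From mathcomp Require Import reals.

Set Implicit Arguments.
Unset Strict Implicit.
Unset Printing Implicit Defensive.

Import Order.TTheory GRing.Theory Num.Theory.
Local Open Scope ring_scope.

(* Combinatorial data of a 2-dimensional cell complex (V, E, F), possibly
   infinite.  A face f is given by its boundary cycle (i_0, ..., i_(n-1)), with
   n = face_size f; ordS is the cyclic successor on 'I_n. *)
Record cell_complex := CellComplex {
  vertex : Type;
  edge : vertex -> vertex -> Prop;
  face : Type;
  face_size : face -> nat;
  boundary : forall f : face, 'I_(face_size f) -> vertex;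
  edge_sym : forall i j, edge i j -> edge j i;
  edge_irrefl : forall i, ~ edge i i;
  face_size_gt2 : forall f, (2 < face_size f)%N;
  boundary_edge :
    forall f (k : 'I_(face_size f)), edge (boundary k) (boundary (ordS k))
}.

Section Area.
Variables (R : realType) (U : vectType R).

Definition is_det_form (det : U -> U -> R) : Prop :=
  (forall u, det u u = 0) /\ (exists u v, det u v != 0).

Definition area (det : U -> U -> R) n (P : {ffun 'I_n -> U}) : R :=
  2^-1 * \sum_(i < n) det (P i) (P (ordS i)).

(* The symmetric bilinear form of the quadratic form [area], by polarization. *)
Definition mixed_area (det : U -> U -> R) n (P Q : {ffun 'I_n -> U}) : R :=
  2^-1 * (area det (P + Q) - area det P - area det Q).

Lemma area_translate (det : {biscalar U}) n (P : {ffun 'I_n -> U}) (w : U) :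
  (forall u, det u u = 0) -> area det [ffun i => P i + w] = area det P.
Proof.
move=> detxx; congr (_ * _).
have detC u v : det u v + det v u = 0.
  by have := detxx (u + v); rewrite linearDl !linearDr /= !detxx addr0 add0r.
under eq_bigr => i _ do
  rewrite !ffunE linearDl !linearDr /= detxx addr0 -addrA.
rewrite !big_split /=.
rewrite [X in _ + (_ + X) = _](_ : _ = \sum_(i < n) det w (P i)); last first.
  by rewrite [RHS](reindex_inj (@ordS_inj n)).
by rewrite -big_split [X in _ + X]big1 ?addr0 // => i _; exact: detC.
Qed.

End Area.

Section PolygonsInSpace.
Variables (R : realType) (U : {vspace 'rV[R]_3}).

Definition in_plane_parallel n (P : {ffun 'I_n -> 'rV[R]_3}) : Prop :=
  exists c : 'rV[R]_3, forall i, P i - c \in U.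

(* A polygon in a plane parallel to U is moved into U by the translation that
   takes its vertex centroid to 0; [vsproj U] restricts to the identity on U.
   [polygon_areaE] shows that any other translation into U gives the same
   area. *)
Definition centroid n (P : {ffun 'I_n -> 'rV[R]_3}) : 'rV[R]_3 :=
  n%:R^-1 *: \sum_(i < n) P i.

Definition translate_into n (P : {ffun 'I_n -> 'rV[R]_3}) :
    {ffun 'I_n -> subvs_of U} :=
  [ffun i => vsproj U (P i - centroid P)].

Definition polygon_area (det : subvs_of U -> subvs_of U -> R) n
    (P : {ffun 'I_n -> 'rV[R]_3}) : R :=
  area det (translate_into P).

Definition polygon_mixed_area (det : subvs_of U -> subvs_of U -> R) n
    (P Q : {ffun 'I_n -> 'rV[R]_3}) : R :=
  mixed_area det (translate_into P) (translate_into Q).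

Lemma polygon_areaE (det : {biscalar subvs_of U}) n
    (P : {ffun 'I_n -> 'rV[R]_3}) (P' : {ffun 'I_n -> subvs_of U}) c :
  (forall u, det u u = 0) -> (forall i, P i = vsval (P' i) + c) ->
  polygon_area det P = area det P'.
Proof.
move=> detxx PE; rewrite -(area_translate P' (vsproj U (c - centroid P)) detxx).
congr area; apply/ffunP => i.
by rewrite !ffunE PE -addrA linearD /= vsvalK.
Qed.

End PolygonsInSpace.

Section Meshes.
Variables (R : realType) (C : cell_complex).
Implicit Types (m s : vertex C -> 'rV[R]_3).

Definition mesh_face m (f : face C) : {ffun 'I_(face_size f) -> 'rV[R]_3} :=
  [ffun k => m (boundary k)].

Definition polyhedral m : Prop :=
  forall f, exists W : {vspace 'rV[R]_3},
    \dim W = 2%N /\ in_plane_parallel W (mesh_face m f).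

Definition no_zero_edges m : Prop := forall i j, edge i j -> m i <> m j.

Definition parallel_meshes m s : Prop :=
  forall i j, edge i j -> ~~ free [:: m i - m j; s i - s j].

Definition offset m s (delta : R) : vertex C -> 'rV[R]_3 :=
  fun i => m i + delta *: s i.

Definition face_mean_curvature (U : {vspace 'rV[R]_3})
    (det : subvs_of U -> subvs_of U -> R) m s (f : face C) : R :=
  - (polygon_mixed_area det (mesh_face m f) (mesh_face s f)
     / polygon_area det (mesh_face m f)).

Definition face_gauss_curvature (U : {vspace 'rV[R]_3})
    (det : subvs_of U -> subvs_of U -> R) m s (f : face C) : R :=
  polygon_area det (mesh_face s f) / polygon_area det (mesh_face m f).

End Meshes.

(* Main.v *)
Require Import Defs.
From HB Require Import structures.
From mathcomp Require Import all_boot all_order all_algebra.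
From mathcomp Require Import reals.
From mathcomp Require Import ring.

(** The law is the expansion of a quadratic form.  The area of a polygon in a
    plane [U] is a quadratic form in the tuple of its vertices, because the
    determinant is bilinear ([area_lincomb]), and moving the centroid to the
    origin and projecting to [U] is linear in the polygon
    ([translate_into_offset]).  Each face of the offset is the combination
    [m(f) + delta s(f)], so its area is
    [A(m(f)) + 2 delta A(m(f), s(f)) + delta^2 A(s(f))]; factoring out
    [A(m(f))], which is nonzero, leaves the two curvatures as coefficients. *)

Set Implicit Arguments.
Unset Strict Implicit.
Unset Printing Implicit Defensive.

Import Order.TTheory GRing.Theory Num.Theory.
Local Open Scope ring_scope.

(** Bilinearity makes the left side a polynomial in [a] and [b] whose cross term
    has the coefficient [X] below.  The mixed area is defined by polarization,
    so the same expansion at [a = b = 1] identifies [X] as twice the mixed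
    area. *)
Lemma area_lincomb (R : realType) (U : vectType R) (det : {biscalar U}) n
    (P Q : {ffun 'I_n -> U}) (a b : R) :
  area det (a *: P + b *: Q) =
    a ^+ 2 * area det P + 2 * a * b * mixed_area det P Q + b ^+ 2 * area det Q.
Proof.
pose X := 2^-1 * \sum_(i < n) (det (P i) (Q (ordS i)) + det (Q i) (P (ordS i))).
have expand c d : area det (c *: P + d *: Q) =
    c ^+ 2 * area det P + c * d * X + d ^+ 2 * area det Q.
  rewrite /area /X.
  have detE i : det ((c *: P + d *: Q) i) ((c *: P + d *: Q) (ordS i)) =
      c ^+ 2 * det (P i) (P (ordS i))
      + c * d * (det (P i) (Q (ordS i)) + det (Q i) (P (ordS i)))
      + d ^+ 2 * det (Q i) (Q (ordS i)).
    by rewrite !ffunE linearDl !linearDr !linearZl_LR !linearZr_LR /=; ring.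
  rewrite (eq_bigr _ (fun i _ => detE i)) !big_split -!mulr_sumr big_split /=.
  by ring.
have := expand 1 1; rewrite !scale1r /mixed_area expand => ->.
by field.
Qed.

(** The centroid and the projection are linear, so bringing a face into [U]
    respects the linear combination of meshes that defines the offset.  This
    reduces areas of faces in space to areas in the fixed plane [U]. *)
Lemma translate_into_offset (R : realType) (C : cell_complex)
    (m s : vertex C -> 'rV[R]_3) (delta : R) (U : {vspace 'rV[R]_3})
    (f : face C) :
  translate_into U (mesh_face (offset m s delta) f) =
    translate_into U (mesh_face m f) + delta *: translate_into U (mesh_face s f).
Proof.
apply/ffunP => i; rewrite !ffunE -linearZ -linearD /=; congr vsproj.
have -> : centroid (mesh_face (offset m s delta) f) =
    centroid (mesh_face m f) + delta *: centroid (mesh_face s f).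
  rewrite /centroid scalerA mulrC -scalerA -scalerDr; congr (_ *: _).
  by rewrite scaler_sumr -big_split; apply: eq_bigr => j _; rewrite !ffunE.
by rewrite scalerBr opprD addrACA.
Qed.

Theorem theorem7 (R : realType) (C : cell_complex)
    (m s : vertex C -> 'rV[R]_3) (delta : R)
    (U : face C -> {vspace 'rV[R]_3})
    (det : forall f : face C, {biscalar (subvs_of (U f))})
    (m_polyhedral : polyhedral m)
    (m_no_zero_edges : no_zero_edges m)
    (ms_parallel : parallel_meshes m s)
    (dimU : forall f, \dim (U f) = 2%N)
    (m_par_U : forall f, in_plane_parallel (U f) (mesh_face m f))
    (s_par_U : forall f, in_plane_parallel (U f) (mesh_face s f))
    (offset_par_U :
      forall f, in_plane_parallel (U f) (mesh_face (offset m s delta) f))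
    (det_form : forall f, is_det_form (det f)) :
  forall f : face C,
    polygon_area (det f) (mesh_face m f) != 0 ->
    polygon_area (det f) (mesh_face (offset m s delta) f) =
      (1 - 2 * delta * face_mean_curvature (det f) m s f
         + delta ^+ 2 * face_gauss_curvature (det f) m s f)
      * polygon_area (det f) (mesh_face m f).
Proof.
move=> f area_neq0.
rewrite /face_mean_curvature /face_gauss_curvature /polygon_mixed_area.
rewrite /polygon_area translate_into_offset.
rewrite -[X in X + delta *: _]scale1r area_lincomb.
by rewrite /polygon_area in area_neq0 *; field.
Qed.
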